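(* Among the $256$ maps $IVT_{i,j}:\mathbb{N}\times\mathbb{N}\to\mathbb{N}\times\mathbb{N}$, $i,j\in\{0,1,\dots,15\}$, there are exactly $16$ for which the dynamical system $x_{n+1}=IVT_{i,j}(x_n)$ is Collatz-like. That is, exactly $16$ pairs $(i,j)\in\{0,\dots,15\}^2$ have the property that for every $x_0\in\mathbb{N}\times\mathbb{N}$ the trajectory $(x_n)_{n\ge 0}$ defined by $x_{n+1}=IVT_{i,j}(x_n)$ eventually converges to the point $(0,0)$.
   Context: $\mathbb{N}$ denotes the natural numbers including $0$. For $i\in\{0,\dots,15\}$, $f_i:\{0,1\}^2\to\{0,1\}$ is the two-variable Boolean function whose truth table is the binary expansion of $i$: $i=\sum_{x,y\in\{0,1\}} f_i(x,y)\,2^{2x+y}$ (so, for example, $f_{12}(x,y)=x$ and $f_{10}(x,y)=y$). For $(m,n)\in\mathbb{N}\times\mathbb{N}$, write $m=\sum_{t=0}^{L-1} m_t2^t$ and $n=\sum_{t=0}^{L-1} n_t2^t$ in binary with $m_t,n_t\in\{0,1\}$, where $L\ge 1$ is the larger of the numbers of binary digits of $m$ and $n$ (the number $0$ has one digit; the shorter expansion is padded with leading zeros). Then $IVT_i(m,n)=\sum_{t=0}^{L-1} f_i(m_t,n_t)2^t$, and $IVT_{i,j}(m,n)=(IVT_i(m,n),IVT_j(m,n))$. A trajectory in $\mathbb{N}\times\mathbb{N}$ eventually converges to $(0,0)$ if there is $n_0$ with $x_n=(0,0)$ for all $n\ge n_0$. The dynamical system $x_{n+1}=IVT_{i,j}(x_n)$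 is called Collatz-like if for every $x_0\in\mathbb{N}\times\mathbb{N}$ its trajectory eventually converges to $(0,0)$. *)

(* Defs.v *)
From mathcomp Require Import all_boot.

Set Implicit Arguments.
Unset Strict Implicit.
Unset Printing Implicit Defensive.

Definition bit (n t : nat) : bool := odd (n %/ 2 ^ t).

(* [trunc_log 2 0 = 0], so 0 has one digit. *)
Definition num_digits (n : nat) : nat := (trunc_log 2 n).+1.

Definition bool_fun (i : 'I_16) (x y : bool) : bool := bit i (2 * x + y).

Definition IVT1 (i : 'I_16) (m n : nat) : nat :=
  \sum_(t < maxn (num_digits m) (num_digits n))
     bool_fun i (bit m t) (bit n t) * 2 ^ t.

Definition IVT (i j : 'I_16) (p : nat * nat) : nat * nat :=
  (IVT1 i p.1 p.2, IVT1 j p.1 p.2).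

Definition eventually_converges_to_origin (x : nat -> nat * nat) : Prop :=
  exists n0 : nat, forall n : nat, n0 <= n -> x n = (0, 0).

Definition Collatz_like (F : nat * nat -> nat * nat) : Prop :=
  forall x : nat -> nat * nat,
    (forall n : nat, x n.+1 = F (x n)) -> eventually_converges_to_origin x.

Lemma bool_funE (i : 'I_16) :
  nat_of_ord i =
    \sum_(x : bool) \sum_(y : bool) bool_fun i x y * 2 ^ (2 * x + y).
Proof.
rewrite !big_bool.
by case: i; do 16!case=> [|] //=.
Qed.

Lemma bitE (n L : nat) :
  num_digits n <= L -> n = \sum_(t < L) bit n t * 2 ^ t.
Proof.
move=> hL; have {hL}: n < 2 ^ L.
  by apply: leq_trans (trunc_log_ltn n (isT : 1 < 2)) _; rewrite leq_exp2l.
elim: L n => [|L IHL] n ltnL; first by rewrite big_ord0; case: n ltnL.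
rewrite big_ord_recl /bit expn0 divn1 muln1 -[LHS]odd_double_half.
congr (_ + _); rewrite [X in X.*2]IHL; last first.
  by rewrite -divn2 ltn_divLR // -expnSr.
rewrite -muln2 big_distrl /=; apply: eq_bigr => t _.
by rewrite /bit -divn2 -divnMA -expnS -mulnA -expnSr.
Qed.

(* Main.v *)
Require Import Defs.
From mathcomp Require Import all_boot.

(** A pair [(i, j)] acts on each pair of digits by one map [g] of [{0,1}^2].
    Starting from [(0, 0)], a Collatz-like system must fix [(0, 0)], so [g]
    fixes [(0, 0)]; leading zeros are then harmless and [IVT_{i,j}] is [g]
    applied digitwise at every position. Hence the system is Collatz-like iff
    [g] fixes [(0, 0)] and [g^3] is constantly [(0, 0)]. These maps are the
    trees on four labelled vertices rooted at [(0, 0)], and there are [4^2]. *)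

Definition digit_map (i j : nat) (b : bool * bool) : bool * bool :=
  (bit i (2 * b.1 + b.2), bit j (2 * b.1 + b.2)).

Definition nilpotent (i j : nat) : bool :=
  (digit_map i j (false, false) == (false, false)) &&
  all (fun b => iter 3 (digit_map i j) b == (false, false))
    [:: (false, false); (false, true); (true, false); (true, true)].

Lemma nilpotentP (i j : nat) :
  reflect (digit_map i j (false, false) = (false, false) /\
           forall b, iter 3 (digit_map i j) b = (false, false))
          (nilpotent i j).
Proof.
apply: (iffP andP) => [[/eqP h0 /allP h3]|[h0 h3]].
  by split=> // b; apply/eqP/h3; case: b => [] [] [].
by split; [apply/eqP | apply/allP => b _; apply/eqP].
Qed.

Lemma iter_fixed (T : Type) (f : T -> T) (x : T) (n : nat) :
  f x = x -> iter n f x = x.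
Proof. by move=> fx; elim: n => //= n ->. Qed.

(** The points of an orbit before its first visit to [y] are distinct and differ from [y], so that
    visit comes within [#|T|.-1] steps; afterwards the orbit stays at [y]. *)
Lemma iter_card_fixed (T : finType) (f : T -> T) (x y : T) (n : nat) :
  f y = y -> iter n f x = y -> iter #|T|.-1 f x = y.
Proof.
move=> fy fnx; have cxy : fconnect f x y by rewrite -fnx fconnect_iter.
have le_k : findex f x y <= #|T|.-1.
  have lt_k := leq_trans (findex_max cxy) (max_card _).
  by rewrite -ltnS (ltn_predK lt_k).
by rewrite -(subnK le_k) iterD iter_findex // iter_fixed.
Qed.

Lemma bit_sum (L : nat) (b : nat -> bool) (s : nat) :
  bit (\sum_(t < L) b t * 2 ^ t) s = (s < L) && b s.
Proof.
elim: L b s => [|L IHL] b s; first by rewrite big_ord0 /bit div0n.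
rewrite big_ord_recl expn0 muln1.
have -> : \sum_(i < L) b (lift ord0 i) * 2 ^ lift ord0 i
    = (\sum_(i < L) b i.+1 * 2 ^ i).*2.
  rewrite -muln2 big_distrl /=; apply: eq_bigr => t _.
  by rewrite -mulnA -expnSr.
case: s => [|s]; first by rewrite /bit divn1 oddD odd_double addbF oddb.
rewrite /bit expnS divnMA divn2 half_bit_double.
exact: (IHL (fun t => b t.+1)).
Qed.

Lemma bit_geq (n t : nat) : num_digits n <= t -> bit n t = false.
Proof.
move=> le_t; rewrite /bit divn_small //.
apply: leq_trans (trunc_log_ltn n (isT : 1 < 2)) _.
by rewrite leq_exp2l.
Qed.

Lemma bit_inj0 (n : nat) : (forall t, bit n t = false) -> n = 0.
Proof.
move=> n0; rewrite [LHS](bitE (leqnn _)).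
by apply: big1 => t _; rewrite n0.
Qed.

(** Beyond the common length both input digits are 0, and the hypothesis makes the right-hand side
    vanish there too. *)
Lemma bit_IVT1 (i : 'I_16) (m n t : nat) :
  bool_fun i false false = false ->
  bit (IVT1 i m n) t = bool_fun i (bit m t) (bit n t).
Proof.
move=> i0; rewrite /IVT1.
rewrite (bit_sum _ (fun t => bool_fun i (bit m t) (bit n t))).
case: ltnP => //=; rewrite geq_max => /andP[hm hn].
by rewrite !bit_geq.
Qed.

(** One-digit inputs give a one-term sum, whatever the value at [(false, false)], so this applies
    before the origin is known to be fixed. *)
Lemma IVT1_bool (i : 'I_16) (x y : bool) : IVT1 i x y = bool_fun i x y.
Proof.
have num_digits_bool (b : bool) : num_digits b = 1 by case: b.
rewrite /IVT1 !num_digits_bool big_ord_recl big_ord0 muln1 addn0.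
by case: x y => [] [].
Qed.

Lemma Collatz_likeP (i j : 'I_16) : nilpotent i j <-> Collatz_like (IVT i j).
Proof.
split=> [/nilpotentP[[i0 j0] nil] x xS|col].
  exists 3 => n /subnK <-; move: (n - 3) => k.
  have bits_x l t : (bit (x (l + k)).1 t, bit (x (l + k)).2 t)
      = iter l (digit_map i j) (bit (x k).1 t, bit (x k).2 t).
    by elim: l => //= l <-; rewrite xS /= !bit_IVT1.
  rewrite addnC [LHS]surjective_pairing; congr (_, _); apply: bit_inj0 => t.
    by have := bits_x 3 t; rewrite nil => -[-> _].
  by have := bits_x 3 t; rewrite nil => -[_ ->].
have orbit b : exists N, forall n, N <= n ->
    iter n (digit_map i j) b = (false, false).
  (* Orbits of the digit map are themselves trajectories of [IVT i j], on one-digit numbers. *)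
  pose x n :=
    let c := iter n (digit_map i j) b in (nat_of_bool c.1, nat_of_bool c.2).
  have [|N xN] := col x; first by move=> n; rewrite /IVT /= !IVT1_bool.
  exists N => n /xN; rewrite /x.
  by case: (iter _ _ _) => [] [] [].
have fix0 : digit_map i j (false, false) = (false, false).
  have [N hN] := orbit (false, false).
  (* With [g] the digit map, [g (0, 0) = g (g^N (0, 0)) = g^(N+1) (0, 0) = (0, 0)]. *)
  by rewrite -{1}(hN N (leqnn N)) -iterS hN.
apply/nilpotentP; split=> // b; have [N hN] := orbit b.
have := iter_card_fixed _ _ _ _ _ fix0 (hN N (leqnn N)).
(* The exponent 3 is [#|bool * bool| - 1]. *)
by rewrite card_prod card_bool.
Qed.

Lemma sum_nilpotent : \sum_(i < 16) \sum_(j < 16) nilpotent i j = 16.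
Proof.
(* Sums over ranges of [nat] evaluate directly, unlike enumerations of ['I_16]. *)
rewrite -(big_mkord xpredT (fun i => \sum_(j < 16) nilpotent i j)).
under eq_bigr => i _ do
  rewrite -(big_mkord xpredT (fun j => nat_of_bool (nilpotent i j))).
by rewrite unlock; vm_compute.
Qed.

Theorem theorem1 :
  exists S : {set 'I_16 * 'I_16},
    (forall i j : 'I_16, (i, j) \in S <-> Collatz_like (IVT i j)) /\
    #|S| = 16.
Proof.
exists [set p : 'I_16 * 'I_16 | nilpotent p.1 p.2]; split=> [i j|].
  by rewrite inE; exact: Collatz_likeP.
rewrite -sum1_card big_mkcond /= -[RHS]sum_nilpotent pair_big /=.
by apply: eq_bigr => p _; rewrite inE; case: nilpotent.
Qed.
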